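(* Let $P$ be a continuous distribution supported on $[0,1]$ with invertible CDF such that the total variation distance between $\mathrm{Unif}(0,1)$ and $P$ is at most $\epsilon\le\frac1{10}$. Then for all $n,m$ and every preference profile $\sigma$, any alternative $b$ maximizing the Borda score satisfies $\mathbb{E}_P[\mathrm{sw}(b,u)]\ge(1-5\epsilon)\max_{j\in A}\mathbb{E}_P[\mathrm{sw}(j,u)]$.
   Context: There are $n$ voters and $m$ alternatives $A=\{1,\dots,m\}$. A preference profile $\sigma$ consists of a ranking of $A$ for each voter; position $1$ is the top. Given a distribution $P$ and profile $\sigma$, a random utility profile $u$ consistent with $\sigma$ is generated as follows: independently for each voter $i$, draw $m$ i.i.d. samples from $P$ and assign them, from highest to lowest, to the alternatives in the order of voter $i$'s ranking. The social welfare of $j$ is $\mathrm{sw}(j,u)=\sum_i u_{ij}$; $\mathbb{E}_P$ is expectation over $u$. The Borda score of alternative $j$ is $\sum_{i=1}^n(m+1-r^j_i)$, where $r^j_i$ is the position of $j$ in voter $i$'s ranking. *)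

(* Defs.v *)
From HB Require Import structures.
From mathcomp Require Import all_boot all_order all_algebra.
From mathcomp Require Import all_classical all_reals all_analysis.
From mathcomp Require Import fingroup perm.
Set Implicit Arguments. Unset Strict Implicit. Unset Printing Implicit Defensive.
Import Order.TTheory GRing.Theory Num.Theory.
Local Open Scope classical_set_scope.
Local Open Scope ring_scope.

Section Defs.
Variable R : realType.

Definition dist_cdf (P : probability R R) (x : R) : R := fine (P [set` `]-oo, x]]).

Definition unif01 (A : set R) : \bar R := lebesgue_measure (A `&` [set` `[0, 1]]).

Definition tv_unif (P : probability R R) : \bar R :=
  ereal_sup [set (`|unif01 A - P A|)%E | A in [set A : set R | measurable A]].

(** Expectation over k i.i.d. samples from P of g (samples), as the
    iterated integral (Tonelli/Fubini) over the k-fold product. *)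
Fixpoint iid_expect (P : probability R R) (k : nat) (g : seq R -> \bar R)
  : \bar R :=
  match k with
  | 0 => g [::]
  | k'.+1 => (\int[P]_x iid_expect P k' (fun s => g (x :: s)))%E
  end.

(** Preference profile: sigma i j = position (0-indexed; 0 = top) of
    alternative j in voter i's ranking. *)
Definition profile (n m : nat) := 'I_n -> {perm 'I_m}.

(** Random utility profile built from n*m samples: voter i uses the block
    of samples i*m .. i*m+m-1, sorted from highest to lowest and assigned
    to alternatives in the order of its ranking. *)
Definition utility (n m : nat) (sigma : profile n m) (s : seq R)
  (i : 'I_n) (j : 'I_m) : R :=
  nth 0 (sort (fun x y : R => y <= x) (take m (drop (i * m) s))) (sigma i j).

Definition sw (n m : nat) (sigma : profile n m) (j : 'I_m) (s : seq R) : R :=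
  \sum_(i < n) utility sigma s i j.

Definition expected_sw (P : probability R R) (n m : nat) (sigma : profile n m)
  (j : 'I_m) : \bar R :=
  iid_expect P (n * m) (fun s => (sw sigma j s)%:E).

(** Borda score: sum_i (m + 1 - r_i^j) with r_i^j the 1-indexed position. *)
Definition borda (n m : nat) (sigma : profile n m) (j : 'I_m) : nat :=
  \sum_(i < n) (m.+1 - (sigma i j).+1)%N.

End Defs.

(* Main.v *)
Require Import Defs.
From HB Require Import structures.
From mathcomp Require Import all_boot all_order all_algebra.
From mathcomp Require Import all_classical all_reals all_analysis.
From mathcomp Require Import perm measurable_realfun.
From mathcomp Require polyrcf.
From mathcomp Require Import zify ring lra.
Import Order.TTheory GRing.Theory Num.Theory.
Local Open Scope classical_set_scope.
Local Open Scope ring_scope.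

(** Replace P by Unif(0,1): the r-th highest of m uniform samples has mean
    (m + 1 - r) / (m + 1), so expected welfare is the Borda score divided by
    m + 1.  The r-th highest of m samples from P exceeds c with probability
    P(Bin(m, P[c, oo)) >= r), and P[c, oo) is within eps of 1 - c; as the
    binomial tail is nondecreasing with values in [0, 1], integrating over c
    shifts each mean by at most eps.  Hence expected welfare is within n eps of
    Borda / (m + 1).  A Borda winner has at least the average Borda score
    n (m + 1) / 2, so an additive error of n eps on both sides is absorbed by
    the factor 1 - 5 eps.

    The integral over c is replaced by Riemann sums, so that only finitely
    valued functions of the samples need exact iterated integrals. *)

(** * Integrals of arbitrary functions over conull sets *)

Section NonmeasurableIntegral.
Context d (T : measurableType d) (R : realType).
Variables (mu : {measure set T -> \bar R}) (D : set T).
Hypotheses (mD : measurable D) (muDC : mu (~` D) = 0%E).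
Import HBNNSimple.
Local Open Scope ereal_scope.

Let ge0_integral_conull (f : T -> \bar R) : (forall x, 0 <= f x) ->
  \int[mu]_x f x = \int[mu]_(x in D) f x.
Proof.
move=> f0; rewrite ge0_integralTE// ge0_integralE//.
apply/eqP; rewrite eq_le; apply/andP; split; apply: ge_ereal_sup => _ [h/= hf <-].
- apply: ereal_sup_ubound; exists (proj_nnsfun h mD) => [x|] /=.
    rewrite patchE mindicE; case: ifPn => _; first by rewrite mulr1.
    by rewrite mulr0.
  have -> : sintegral mu h = \int[mu]_x (h x)%:E.
    by rewrite integral_nnsfun// patch_setT.
  rewrite (@ge0_negligible_integral _ _ _ _ _ (~` D))//; last 3 first.
  - exact: measurableC.
  - exact/measurable_EFinP.
  - by move=> x _; rewrite lee_fin.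
  by rewrite setDE setCK setTI integral_nnsfun// mrestrict.
- apply: ereal_sup_ubound; exists h => //= x.
  apply: (le_trans (hf x)); rewrite patchE; case: ifPn => //.
Qed.

Lemma integral_conull (f : T -> \bar R) :
  \int[mu]_x f x = \int[mu]_(x in D) f x.
Proof. by rewrite integralE [RHS]integralE !ge0_integral_conull. Qed.

(* No measurability is needed: for nonnegative integrands the integral is a
   supremum over the simple functions below. *)
Lemma ge0_le_integral_conull (f g : T -> \bar R) :
  (forall x, D x -> 0 <= f x) -> (forall x, D x -> f x <= g x) ->
  \int[mu]_x f x <= \int[mu]_x g x.
Proof.
move=> f0 fg; rewrite !integral_conull ge0_integralE// ge0_integralE; last first.
  by move=> x Dx; apply: le_trans (fg x Dx); exact: f0.
apply: le_ereal_sup => _ [h/= hf <-]; exists h => //= x.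
apply: (le_trans (hf x)); rewrite !patchE; case: ifPn => // /set_mem; exact: fg.
Qed.

End NonmeasurableIntegral.

(** * Iterated expectations over independent samples *)

Section IteratedExpectation.
Context {R : realType} (P : probability R R).

(* Iterated integrals as a relation, carrying integrability at every level so
   that linearity applies. *)
Fixpoint has_iid (k : nat) (g : seq R -> R) (v : R) : Prop :=
  match k with
  | 0 => g [::] = v
  | k'.+1 => exists f : R -> R,
      [/\ forall x, has_iid k' (fun s => g (x :: s)) (f x),
          P.-integrable setT (EFin \o f) & (\int[P]_x (f x)%:E = v%:E)%E]
  end.

Lemma has_iidE k g v : has_iid k g v -> iid_expect P k (fun s => (g s)%:E) = v%:E.
Proof.
elim: k g v => [|k IH] g v /=; first by move=> ->.
by move=> [f [gf _ <-]]; apply: eq_integral => x _; exact: IH.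
Qed.

Lemma integral_probability_cst (c : R) : (\int[P]_x (cst c x)%:E = c%:E)%E.
Proof.
apply: etrans (integral_cst P measurableT c%:E) _.
exact: etrans (congr1 (mule c%:E) (probability_setT P)) (mule1 _).
Qed.

Lemma has_iid_cst k c : has_iid k (cst c) c.
Proof.
elim: k => //= k IH; exists (cst c); split => //.
  exact: finite_measure_integrable_cst.
exact: integral_probability_cst.
Qed.

Lemma has_iidD k g h u v : has_iid k g u -> has_iid k h v ->
  has_iid k (fun s => g s + h s) (u + v).
Proof.
elim: k g h u v => [|k IH] g h u v /=; first by move=> -> ->.
move=> [f [gf intf fu]] [f' [hf' intf' f'v]].
exists (fun x => f x + f' x); split => [x||]; first exact: IH.
  exact: (integrableD _ intf intf').
by rewrite EFinD -fu -f'v -integralD_EFin.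
Qed.

Lemma has_iidZ k c g v : has_iid k g v -> has_iid k (fun s => c * g s) (c * v).
Proof.
elim: k g v => [|k IH] g v /=; first by move=> ->.
move=> [f [gf intf fv]]; exists (fun x => c * f x); split => [x||]; first exact: IH.
  exact: (integrableZl _ _ intf).
by rewrite EFinM -fv -integralZl.
Qed.

Lemma has_iid_sum k (I : Type) (r : seq I) (g : I -> seq R -> R) (v : I -> R) :
  (forall i, has_iid k (g i) (v i)) ->
  has_iid k (fun s => \sum_(i <- r) g i s) (\sum_(i <- r) v i).
Proof.
move=> gv; elim: r => [|i r IH].
  rewrite big_nil (_ : (fun s => _) = cst 0); last by apply/funext => s; rewrite big_nil.
  exact: has_iid_cst.
rewrite big_cons (_ : (fun s => _) = fun s => g i s + \sum_(j <- r) g j s); last first.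
  by apply/funext => s; rewrite big_cons.
exact: has_iidD.
Qed.

(** Integrating out an unread sample changes nothing, as [P] has mass 1. Together with
    [has_iid_drop] this isolates one voter's block. *)
Lemma has_iid_take m k g v : has_iid m g v -> has_iid (m + k) (fun s => g (take m s)) v.
Proof.
elim: m g v => [|m IH] g v /=.
  move=> <-; rewrite (_ : (fun s => _) = cst (g [::])); first exact: has_iid_cst.
  by apply/funext => s; rewrite take0.
by move=> [f [gf intf fv]]; exists f; split => // x; exact: (IH (fun s => g (x :: s))).
Qed.

Lemma has_iid_drop a k g v : has_iid k g v -> has_iid (a + k) (fun s => g (drop a s)) v.
Proof.
move=> gv; elim: a => [|a IH] /=; first by under eq_fun do rewrite drop0.
exists (cst v); split => //; first exact: finite_measure_integrable_cst.
exact: integral_probability_cst.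
Qed.

(** Passes bounds valid only for samples in the support to the iterated integrals. It applies to
    [sw], which depends on the samples through sorting, without a measurability proof. *)
Lemma le_iid_expect (D : set R) k (g h : seq R -> \bar R) :
  measurable D -> P (~` D) = 0%E ->
  (forall s, size s = k -> (forall x, x \in s -> D x) -> (0 <= g s)%E) ->
  (forall s, size s = k -> (forall x, x \in s -> D x) -> (g s <= h s)%E) ->
  (iid_expect P k g <= iid_expect P k h)%E.
Proof.
move=> mD PD.
have cons_in x s : D x -> (forall y, y \in s -> D y) -> forall y, y \in x :: s -> D y.
  by move=> Dx Ds y; rewrite inE => /predU1P[->|/Ds].
(* Nonnegativity joins the induction because comparing the outer integrals requires nonnegative
   inner ones. *)
suff: (forall s, size s = k -> (forall x, x \in s -> D x) -> (0 <= g s)%E) ->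
  (forall s, size s = k -> (forall x, x \in s -> D x) -> (g s <= h s)%E) ->
  (0 <= iid_expect P k g)%E /\ (iid_expect P k g <= iid_expect P k h)%E.
  by move=> H g0 gh; have [] := H g0 gh.
elim: k g h => [|k IH] g h g0 gh /=; first by split; [exact: g0|exact: gh].
have H x : D x -> (0 <= iid_expect P k (fun s => g (x :: s)))%E /\
    (iid_expect P k (fun s => g (x :: s)) <= iid_expect P k (fun s => h (x :: s)))%E.
  move=> Dx; apply: IH => s sk Ds.
    by apply: g0; [rewrite /= sk|exact: cons_in].
  by apply: gh; [rewrite /= sk|exact: cons_in].
split.
  rewrite (@integral_conull _ _ _ _ D)//.
  by apply: integral_ge0 => x /H[].
by apply: (@ge0_le_integral_conull _ _ _ P D mD PD) => x Dx; have [] := H x Dx.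
Qed.

End IteratedExpectation.

(** * Binomial tails and their primitives *)

(* As a polynomial in p, [btail m k] is P(Bin(m, p) >= k). *)
Fixpoint btail (R : realType) (m k : nat) : {poly R} :=
  match m, k with
  | _, 0 => 1
  | 0, _.+1 => 0
  | m'.+1, k'.+1 => 'X * btail R m' k' + (1 - 'X) * btail R m' k'.+1
  end.

Lemma btail0 (R : realType) (m : nat) : btail R m 0 = 1. Proof. by case: m. Qed.

Lemma horner_btail0 (R : realType) (m : nat) (x : R) : (btail R m 0).[x] = 1.
Proof. by rewrite btail0 -[1]/(1%:P) hornerC. Qed.

Lemma btailSS (R : realType) (m k : nat) :
  btail R m.+1 k.+1 = 'X * btail R m k + (1 - 'X) * btail R m k.+1.
Proof. by []. Qed.

Lemma horner_btailSS (R : realType) (m k : nat) (x : R) :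
  (btail R m.+1 k.+1).[x] = x * (btail R m k).[x] + (1 - x) * (btail R m k.+1).[x].
Proof. by rewrite btailSS !hornerE. Qed.

Lemma btail_gt (R : realType) (m k : nat) : (m < k)%N -> btail R m k = 0.
Proof.
elim: m k => [|m IH] [|k]//= mk.
by rewrite !IH ?mulr0 ?addr0// ltnW.
Qed.

Lemma horner0_btail (R : realType) (m k : nat) : (btail R m k.+1).[0] = 0.
Proof.
elim: m => [|m IH]; first by rewrite horner0.
by rewrite horner_btailSS IH mulr0 mul0r addr0.
Qed.

Lemma horner1_btail (R : realType) (m k : nat) : (k <= m)%N -> (btail R m k).[1] = 1.
Proof.
elim: m k => [|m IH] [|k]// km; rewrite ?horner_btail0//.
by rewrite horner_btailSS IH// subrr mul0r mulr1 addr0.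
Qed.

Lemma btail_ge0 (R : realType) (m k : nat) (x : R) :
  0 <= x <= 1 -> 0 <= (btail R m k).[x].
Proof.
move=> x01; elim: m k => [|m IH] [|k]; rewrite ?horner_btail0//.
  by rewrite btail_gt// horner0.
by rewrite horner_btailSS; have := IH k; have := IH k.+1; nra.
Qed.

Lemma btail_anti (R : realType) (m k : nat) (x : R) :
  0 <= x <= 1 -> (btail R m k.+1).[x] <= (btail R m k).[x].
Proof.
move=> x01; elim: m k => [|m IH] k.
  by rewrite btail_gt// horner0 btail_ge0.
case: k => [|k]; last first.
  by rewrite !horner_btailSS; have := IH k; have := IH k.+1; nra.
by rewrite horner_btailSS !horner_btail0; have := IH 0; rewrite horner_btail0; nra.
Qed.

(** The recursion is a convex combination of two nondecreasing tails. Raising [x] also moves weight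
    to the larger one, by [btail_anti]. *)
Lemma btail_homo (R : realType) (m k : nat) (x y : R) :
  0 <= x -> x <= y -> y <= 1 -> (btail R m k).[x] <= (btail R m k).[y].
Proof.
move=> x0 xy y1; elim: m k => [|m IH] [|k]; rewrite ?horner_btail0//.
  by rewrite btail_gt// !horner0.
rewrite !horner_btailSS.
have := btail_anti R m k x; have -> : 0 <= x <= 1 by lra.
by move=> /(_ isT); have := IH k; have := IH k.+1; nra.
Qed.

Lemma deriv_btail (R : realType) (m k : nat) :
  (btail R m.+1 k.+1)^`() = (btail R m k - btail R m k.+1) *+ m.+1.
Proof.
have d1 : (1 : {poly R})^`() = 0 by exact: derivC.
have dX : (1 - 'X : {poly R})^`() = -1 by rewrite derivB derivX d1 sub0r.
elim: m k => [|m IH] k.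
  case: k => [|k]; first by rewrite btailSS btail0 btail_gt// mulr1 mulr0 addr0 derivX subr0.
  by rewrite !btail_gt// subr0 mul0rn deriv0.
rewrite btailSS derivD !derivM derivX dX IH.
case: k => [|k].
  rewrite !btail0 d1 !btailSS btail0 -!(mulr_natr (_ - _)) -(natr1 m.+1).
  by move: (m.+1%:R) (btail R m 1) => a b; ring.
rewrite IH !btailSS -!(mulr_natr (_ - _)) -(natr1 m.+1).
by move: (m.+1%:R) (btail R m k) (btail R m k.+1) (btail R m k.+2) => a b c d; ring.
Qed.

(* The derivative of P(Bin(m + 1, p) >= j + 1) in p is
   (m + 1) (P(Bin(m, p) >= j) - P(Bin(m, p) >= j + 1)), which telescopes. *)
Definition btail_prim (R : realType) (m k : nat) : {poly R} :=
  m.+1%:R^-1 *: \sum_(k <= j < m.+1) btail R m.+1 j.+1.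

Lemma deriv_btail_prim (R : realType) (m k : nat) :
  (k <= m)%N -> (btail_prim R m k)^`() = btail R m k.
Proof.
move=> km; rewrite derivZ raddf_sum /=.
under eq_bigr do rewrite deriv_btail.
rewrite sumrMnl (telescope_sumr_eq (fun j => - btail R m j)); last first.
- by move=> j _; rewrite opprK addrC.
- exact: leqW.
rewrite btail_gt// oppr0 sub0r opprK -(scaler_nat m.+1 (btail R m k)) scalerA mulVf.
  by rewrite scale1r.
by rewrite pnatr_eq0.
Qed.

Lemma horner0_btail_prim (R : realType) (m k : nat) : (btail_prim R m k).[0] = 0.
Proof. by rewrite hornerZ horner_sum big1 ?mulr0// => j _; rewrite horner0_btail. Qed.

(** As the primitive vanishes at 0, this is the integral of the tail over [0, 1]: for [0 < k <= m],
    the mean of the [k]-th highest of [m] uniform samples. *)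
Lemma horner1_btail_prim (R : realType) (m k : nat) :
  (btail_prim R m k).[1] = (m.+1 - k)%:R / m.+1%:R.
Proof.
rewrite hornerZ horner_sum mulrC; congr (_ * _).
rewrite big_nat_cond (eq_bigr (fun=> 1)) => [|j]; last first.
  by rewrite andbT => /andP[_ jm]; rewrite horner1_btail.
by rewrite -big_nat_cond sumr_const_nat.
Qed.

(** The mean value theorem gives the increment as [y - x] times the tail at an intermediate point;
    monotonicity bounds that tail. *)
Lemma btail_prim_bounds (R : realType) (m k : nat) (x y : R) :
  (k <= m)%N -> 0 <= x -> x <= y -> y <= 1 ->
  (y - x) * (btail R m k).[x] <= (btail_prim R m k).[y] - (btail_prim R m k).[x] <=
  (y - x) * (btail R m k).[y].
Proof.
move=> km x0; rewrite le_eqVlt => /predU1P[->|xy y1]; first by rewrite !subrr !mul0r lexx.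
have [c] := polyrcf.poly_mvt (btail_prim R m k) xy.
rewrite in_itv/= => /andP[xc cy] ->; rewrite deriv_btail_prim// (mulrC _ (y - x)).
by rewrite !ler_pM2l ?subr_gt0// !btail_homo//; lra.
Qed.


(** * Riemann sums of a monotone function at perturbed nodes *)

Section RiemannSum.
Context {R : realType} (h H : R -> R).
Hypotheses (h0 : h 0 = 0) (h1 : h 1 = 1).
Hypothesis hmono : forall x y, 0 <= x -> x <= y -> y <= 1 -> h x <= h y.
Hypothesis Hh : forall x y, 0 <= x -> x <= y -> y <= 1 ->
  (y - x) * h x <= H y - H x <= (y - x) * h y.

(* [h] and its primitive [H] extended from [0, 1] to the whole line. *)
Let clamp (x : R) := Num.max 0 (Num.min x 1).
Let G x := H (clamp x) + Num.max 0 (x - 1).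

Let clampE x : [\/ [/\ x <= 0, clamp x = 0 & G x = H 0],
  [/\ 0 <= x <= 1, clamp x = x & G x = H x] |
  [/\ 1 <= x, clamp x = 1 & G x = H 1 + (x - 1)]].
Proof.
rewrite /G /clamp; have [x0|x0] := leP x 0.
  have xB1 : x - 1 <= 0 by lra.
  have x1 : x <= 1 by lra.
  by constructor 1; rewrite (min_idPl _) ?(max_idPl _)// addr0.
have [x1|x1] := leP x 1.
  by constructor 2; rewrite (max_idPr (ltW x0)) (max_idPl _) ?addr0 ?(ltW x0)//; lra.
by constructor 3; rewrite (max_idPr ler01) (max_idPr _) ?(ltW x1)//; lra.
Qed.

(** [G] is a primitive of [h] composed with [clamp]: it is constant left of 0, where [h 0 = 0], and
    has slope 1 right of 1, where [h 1 = 1]. *)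
Let GB x y : x <= y ->
  (y - x) * h (clamp x) <= G y - G x <= (y - x) * h (clamp y).
Proof.
rewrite le_eqVlt => /predU1P[->|xy]; first by rewrite !subrr !mul0r lexx.
have H01 := Hh _ _ (lexx 0) ler01 (lexx 1); rewrite h0 h1 in H01.
case: (clampE x) => -[x0 -> ->]; case: (clampE y) => -[y0 -> ->]; rewrite ?h0 ?h1.
- lra.
- have /andP[y0' y1] := y0; have := Hh _ _ (lexx 0) y0' y1.
  have := hmono _ _ (lexx 0) y0' y1; rewrite h0; nra.
- lra.
- lra.
- by apply: Hh; lra.
- have /andP[x0' x1] := x0; have := Hh _ _ x0' x1 (lexx 1).
  have := hmono _ _ x0' x1 (lexx 1); rewrite h1; nra.
- lra.
- lra.
- lra.
Qed.

(** Moving every node by [e] down or up brackets the sum, by monotonicity, between telescoping sums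
    of increments of [G]. Restoring the limits 0 and 1 costs at most [e + d], since the clamped [h]
    lies in [0, 1]. Clamping is what allows shifted nodes to leave [0, 1]. *)
Lemma riemann_sum_perturbed (N : nat) (p : nat -> R) (e : R) :
  (0 < N)%N -> 0 <= e ->
  (forall k, (0 < k <= N)%N -> 0 <= p k <= 1 /\ `|p k - (1 - k%:R / N%:R)| <= e) ->
  `|N%:R^-1 * (\sum_(k < N) h (p k.+1)) - (H 1 - H 0)| <= e + N%:R^-1.
Proof.
move=> N0 e0; set d := N%:R^-1 : R => hp.
have d0 : 0 < d by rewrite invr_gt0 ltr0n.
have Nd : N%:R * d = 1 by rewrite mulfV// pnatr_eq0 -lt0n.
have hclamp k : (0 < k <= N)%N -> h (p k) = h (clamp (p k)).
  move=> /hp[p01 _]; case: (clampE (p k)) => -[pk -> _] //; congr h; lra.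
have hc x y : x <= y -> h (clamp x) <= h (clamp y).
  by move=> xy; case: (clampE x) => -[x0 -> _]; case: (clampE y) => -[y0 -> _]; apply: hmono; lra.
have lo : G (1 - d - e) - G (- d - e) <= d * \sum_(k < N) h (p k.+1).
  pose f k := - G (1 - k.+1%:R * d - e).
  have -> : G (1 - d - e) - G (- d - e) = f N - f 0.
    rewrite /f opprK [RHS]addrC; congr (G _ - G _); first by rewrite mul1r.
    by rewrite -natr1 mulrDl Nd mul1r; ring.
  rewrite -(telescope_sumr f (leq0n N)) big_mkord mulr_sumr; apply: ler_sum => k _.
  have kN : (0 < k.+1 <= N)%N by rewrite ltn_ord.
  have [p01] := hp _ kN; rewrite ler_norml => /andP[pl _].
  rewrite hclamp// /f opprK addrC.
  have /andP[_ /le_trans ->//] :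
      (d * h (clamp (1 - k.+2%:R * d - e)) <=
       G (1 - k.+1%:R * d - e) - G (1 - k.+2%:R * d - e) <=
       d * h (clamp (1 - k.+1%:R * d - e))).
    have := GB (1 - k.+2%:R * d - e) (1 - k.+1%:R * d - e).
    have -> : 1 - k.+1%:R * d - e - (1 - k.+2%:R * d - e) = d by rewrite -(natr1 k.+1); ring.
    by apply; rewrite -(natr1 k.+1) mulrDl mul1r; lra.
  rewrite ler_pM2l//; apply: hc; lra.
have up : d * \sum_(k < N) h (p k.+1) <= G (1 + e) - G e.
  pose f k := - G (1 - k%:R * d + e).
  have -> : G (1 + e) - G e = f N - f 0.
    by rewrite /f opprK [RHS]addrC; congr (G _ - G _); rewrite ?Nd; ring.
  rewrite -(telescope_sumr f (leq0n N)) big_mkord mulr_sumr; apply: ler_sum => k _.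
  have kN : (0 < k.+1 <= N)%N by rewrite ltn_ord.
  have [p01] := hp _ kN; rewrite ler_norml => /andP[_ pu].
  rewrite hclamp// /f opprK addrC.
  have /andP[+ _] :
      (d * h (clamp (1 - k.+1%:R * d + e)) <=
       G (1 - k%:R * d + e) - G (1 - k.+1%:R * d + e) <=
       d * h (clamp (1 - k%:R * d + e))).
    have := GB (1 - k.+1%:R * d + e) (1 - k%:R * d + e).
    have -> : 1 - k%:R * d + e - (1 - k.+1%:R * d + e) = d by rewrite -(natr1 k); ring.
    by apply; rewrite -(natr1 k) mulrDl mul1r; lra.
  apply: le_trans; rewrite ler_pM2l//; apply: hc; lra.
have hc01 x : 0 <= h (clamp x) <= 1.
  by rewrite -{1}h0 -h1; case: (clampE x) => -[x0 -> _]; apply/andP; split; apply: hmono; lra.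
have G1 : G 1 = H 1 by case: (clampE 1) => -[x0 _ ->] //; lra.
have G0 x : x <= 0 -> G x = H 0.
  move=> x0; case: (clampE x) => -[x0' _ ->] //; last by lra.
  by have -> : x = 0 by lra.
have /andP[_ b1] : (1 - (1 - d - e)) * h (clamp (1 - d - e)) <= G 1 - G (1 - d - e) <=
    (1 - (1 - d - e)) * h (clamp 1).
  by apply: GB; lra.
have /andP[_ b2] : (1 + e - 1) * h (clamp 1) <= G (1 + e) - G 1 <=
    (1 + e - 1) * h (clamp (1 + e)).
  by apply: GB; lra.
have /andP[b3 _] : (e - 0) * h (clamp 0) <= G e - G 0 <= (e - 0) * h (clamp e).
  by apply: GB; lra.
have := hc01 1; have := hc01 (1 + e); have := hc01 0 => c1 c2 c3.
have e1 : G (- d - e) = H 0 by apply: G0; lra.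
have e2 : G 0 = H 0 by apply: G0.
rewrite ler_norml; apply/andP; split; nra.
Qed.

End RiemannSum.

(** * Order statistics as threshold counts *)

Section SortedCount.
Context {R : realType}.
Implicit Types (s : seq R) (c : R).

(** In a decreasing list the entries at least [c] form a prefix. This trades an order statistic for
    a count, whose law is binomial. *)
Lemma le_nth_sort_count c s r : (r < size s)%N ->
  (c <= nth 0 (sort (fun x y : R => y <= x) s) r) = (r < count (fun y => c <= y)%R s)%N.
Proof.
pose ge := fun x y : R => y <= x.
have tge : total ge by move=> x y; rewrite /ge; exact: le_total.
have trge : transitive ge by move=> y x z; rewrite /ge => xy /le_trans; exact.
rewrite -(size_sort ge) -(seq.permP (permEl (perm_sort ge s))).
have := sort_sorted tge s; move: (sort ge s) => {s}.
move=> t; elim: t r => [|x t IH] r //= xt.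
have /allP tx := order_path_min trge xt.
have [cx|xc] /= := boolP (c <= x).
  by case: r => [|r]; rewrite ?ltnS//= => rt; rewrite IH// (path_sorted xt).
have c0 : count (fun y => c <= y) t = 0%N.
  apply/eqP; rewrite -leqn0 leqNgt -has_count; apply/hasPn => y /tx yx.
  by rewrite -ltNge (le_lt_trans yx)// ltNge.
rewrite c0; case: r => [|r]; rewrite ?ltnS ?(negbTE xc)//= => rt.
by rewrite IH ?c0// (path_sorted xt).
Qed.

(** Discrete layer-cake formula: the sum counts the multiples of [1 / N] in (0, y], so it is the
    integer part of [y * N]. *)
Lemma discretize (N : nat) (y : R) : (0 < N)%N -> 0 <= y <= 1 ->
  N%:R^-1 * (\sum_(k < N) (k.+1%:R / N%:R <= y)%R%:R) <= y <=
  N%:R^-1 * (\sum_(k < N) (k.+1%:R / N%:R <= y)%R%:R) + N%:R^-1.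
Proof.
move=> N0 /andP[y0 y1]; have NR : 0 < N%:R :> R by rewrite ltr0n.
under eq_bigr do rewrite ler_pdivrMr//.
have z0 : 0 <= y * N%:R by rewrite mulr_ge0// ltW.
have zN : y * N%:R <= N%:R by rewrite ler_piMl// ltW.
(* The number of summands is freed from [N] for induction; the last clause fixes the sum when [z]
   lies beyond all earlier thresholds. *)
have key z n : 0 <= z -> let S : R := \sum_(k < n) (k.+1%:R <= z)%R%:R in
    [/\ S <= z, z <= n%:R -> z <= S + 1 & n%:R <= z -> S = n%:R].
  move=> {}z0; elim: n => [|n [IH1 IH2 IH3]] S; rewrite /S.
    by rewrite big_ord0; split => //; lra.
  rewrite big_ord_recr/= -natr1; have [nz|zn] := leP (n%:R + 1) z; rewrite /= ?mulr1n ?mulr0n.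
    by rewrite IH3; [split; lra|lra].
  rewrite addr0; split; [exact: IH1| |lra].
  have [zn'|nz] := leP z n%:R => _; first exact: IH2.
  by rewrite IH3; lra.
have [/= S1 S2 _] := key _ N z0; have {}S2 := S2 zN.
rewrite !(mulrC N%:R^-1) -[X in _ <= _ + X]mul1r -mulrDl.
by rewrite ler_pdivrMr// ler_pdivlMr// S1 S2.
Qed.

End SortedCount.

(** * Tail probabilities of [P] and total variation *)

Section SampleTails.
Context {R : realType} (P : probability R R).

Definition utail (c : R) : R := fine (P [set` `[c, +oo[]).

(** Conditioning on the first sample, which reaches [c] with probability [utail c], reproduces the
    recursion of [btail]. *)
Lemma has_iid_count c m k :
  has_iid P m (fun s => (k <= count (fun y => c <= y)%R s)%N%:R) (btail R m k).[utail c].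
Proof.
elim: m k => [|m IH] [|k].
- by rewrite horner_btail0.
- by rewrite btail_gt//= horner0.
- by rewrite horner_btail0; exact: (has_iid_cst P m.+1 1).
pose a := (btail R m k).[utail c]; pose b := (btail R m k.+1).[utail c].
pose A := [set` `[c, +oo[] : set R.
have mA : measurable A by exact: measurable_itv.
have i1 : P.-integrable setT (EFin \o cst b) by exact: finite_measure_integrable_cst.
have i2 : P.-integrable setT (fun x => (\1_A x)%:E) by exact: integrable_indic.
(* The inner expectation is [a] when the first sample reaches [c] and [b] otherwise; the affine form
   makes it integrable by linearity. *)
exists (fun x => b + (a - b) * \1_A x); split.
- move=> x; rewrite indicE /A mem_setE in_itv/= andbT.
  have [cx|xc] := boolP (c <= x).
    by rewrite mulr1 addrC subrK; exact: IH.
  by rewrite mulr0 addr0; exact: IH.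
- exact: (integrableD measurableT i1 (integrableZl measurableT (a - b) i2)).
have PA : P A = (utail c)%:E by rewrite fineK// fin_num_measure.
rewrite (_ : (fun x => _) = fun x => (EFin \o cst b) x + (a - b)%:E * (\1_A x)%:E)%E//.
rewrite integralD//; last exact: integrableZl.
rewrite integralZl// integral_indic// setIT integral_probability_cst [X in (_ * X)%E]PA.
by rewrite -EFinM -EFinD horner_btailSS -/a -/b; congr EFin; ring.
Qed.

(** Total variation is tested on the half-line from [c], whose uniform mass is [1 - c]. *)
Lemma utail_bounds (eps c : R) : (tv_unif P <= eps%:E)%E -> 0 <= c <= 1 ->
  0 <= utail c <= 1 /\ `|utail c - (1 - c)| <= eps.
Proof.
move=> Ptv /andP[c0 c1]; pose A := [set` `[c, +oo[] : set R.
have mA : measurable A by exact: measurable_itv.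
have PA : P A = (utail c)%:E by rewrite fineK// fin_num_measure.
split; first by rewrite -!lee_fin -PA measure_ge0 probability_le1.
have UA : unif01 A = (1 - c)%:E.
  rewrite /unif01 (_ : A `&` _ = [set` `[c, 1]]).
    by rewrite lebesgue_measure_itv/= lte_fin; case: ltgtP c1 => // ->; rewrite subrr.
  apply/seteqP; split => x; rewrite /A /= !in_itv/= ?andbT.
    by move=> [cx /andP[_ x1]]; rewrite cx.
  by move=> /andP[cx ->]; rewrite cx (le_trans c0).
rewrite distrC -lee_fin; apply: le_trans Ptv; apply: ereal_sup_ubound.
by exists A => //; rewrite UA PA.
Qed.

Lemma tv_unif_ge0 : (0 <= tv_unif P)%E.
Proof.
have U0 : unif01 (set0 : set R) = 0%E by rewrite /unif01 set0I measure0.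
by apply: ereal_sup_ubound; exists set0; [exact: measurable0|rewrite U0 measure0 sube0 abse0].
Qed.

End SampleTails.

(** * Expected welfare against normalized Borda score *)

Section ExpectedWelfare.
Context {R : realType} (P : probability R R) (eps : R).
Hypotheses (Psupp : P [set` `[0, 1]] = 1%E) (Ptv : (tv_unif P <= eps%:E)%E).

(** Each utility lies between the step function [L i] and [L i + N^-1], and [L i] has the exact
    expectation [w i]. The upper bound thus carries a second [N^-1] on top of the Riemann error. *)
Lemma expected_sw_approx (n m : nat) (sigma : profile n m) (j : 'I_m) (N : nat) :
  (0 < N)%N ->
  (((borda sigma j)%:R / m.+1%:R - n%:R * (eps + N%:R^-1))%:E <= expected_sw P sigma j /\
   expected_sw P sigma j <= ((borda sigma j)%:R / m.+1%:R + n%:R * (eps + N%:R^-1 *+ 2))%:E)%E.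
Proof.
move=> N0; have NR : 0 < N%:R :> R by rewrite ltr0n.
pose D := [set` `[0, 1]] : set R.
have mD : measurable D by exact: measurable_itv.
have PD : P (~` D) = 0%E by rewrite probability_setC// Psupp subee.
have eps0 : 0 <= eps by rewrite -lee_fin (le_trans (tv_unif_ge0 P)).
pose thr (k : nat) : R := k%:R / N%:R.
pose blk (i : 'I_n) (s : seq R) := take m (drop (i * m) s).
pose exc i (k : 'I_N) (s : seq R) : R :=
  ((sigma i j).+1 <= count (fun y => thr k.+1 <= y)%R s)%N%:R.
pose L i s : R := N%:R^-1 * \sum_(k < N) exc i k (blk i s).
pose w i : R := N%:R^-1 * \sum_(k < N) (btail R m (sigma i j).+1).[utail P (thr k.+1)].
have Lw i : has_iid P (n * m) (L i) (w i).
  apply: has_iidZ; apply: has_iid_sum => k.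
  (* Samples before voter [i]'s block, the block itself, and those after it. *)
  have -> : (n * m = i * m + (m + (n - i.+1) * m))%N.
    by rewrite addnA -mulSnr -mulnDl subnKC.
  apply: (has_iid_drop _ _ _ (fun s => exc i k (take m s))).
  apply: (has_iid_take _ _ _ (exc i k)).
  exact: has_iid_count.
have wb i : `|w i - (m - sigma i j)%:R / m.+1%:R| <= eps + N%:R^-1.
  have sm : ((sigma i j).+1 <= m)%N by exact: ltn_ord.
  have := riemann_sum_perturbed (fun x => (btail R m (sigma i j).+1).[x])
    (fun x => (btail_prim R m (sigma i j).+1).[x]) (horner0_btail R _ _) (horner1_btail R _ _ sm)
    (btail_homo R _ _) _ N (fun k => utail P (thr k)) eps N0 eps0 _.
  rewrite horner1_btail_prim horner0_btail_prim subr0 subSS; apply.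
    by move=> x y; exact: btail_prim_bounds.
  move=> k /andP[k0 kN]; apply: utail_bounds => //.
  by rewrite divr_ge0//= ler_pdivrMr// mul1r ler_nat.
have Lu s : size s = (n * m)%N -> (forall x, x \in s -> D x) ->
    forall i, 0 <= L i s /\ (L i s <= utility sigma s i j <= L i s + N%:R^-1).
  move=> sz Ds i; split.
    by rewrite mulr_ge0 ?invr_ge0 ?(ltW NR)// sumr_ge0.
  have szb : size (blk i s) = m.
    rewrite size_takel// size_drop sz -mulnBl leq_pmull// subn_gt0//.
  have srt : (sigma i j < size (blk i s))%N by rewrite szb.
  have := discretize N (utility sigma s i j) N0.
  under eq_bigr do rewrite /utility le_nth_sort_count//.
  (* The utility is an actual sample, not the default of [nth], so it lies in [0, 1]. *)
  apply; suff : D (utility sigma s i j) by rewrite /D/= in_itv.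
  apply: Ds; apply: (@mem_drop (i * m) _ s); apply: (@mem_take m).
  rewrite -(mem_sort (fun x y : R => y <= x)); apply: mem_nth.
  by rewrite size_sort.
have bE : (borda sigma j)%:R / m.+1%:R = \sum_(i < n) ((m - sigma i j)%:R / m.+1%:R) :> R.
  by rewrite /borda natr_sum mulr_suml; apply: eq_bigr => i _; rewrite subSS.
have cstE (x : R) : n%:R * x = \sum_(i < n) x by rewrite sumr_const card_ord mulr_natl.
rewrite bE !cstE -sumrB -big_split/=; split.
- apply: (@le_trans _ _ (iid_expect P (n * m) (fun s => (\sum_(i < n) L i s)%:E))).
    rewrite (has_iidE _ _ _ _ (has_iid_sum _ _ _ _ _ _ Lw)) lee_fin.
    apply: ler_sum => i _; have := wb i; rewrite ler_norml => /andP[].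
    by move: (_ / m.+1%:R) (w i) => x y; lra.
  apply: (le_iid_expect P D) => // s sz Ds.
    by rewrite lee_fin; apply: sumr_ge0 => i _; have [] := Lu s sz Ds i.
  by rewrite lee_fin; apply: ler_sum => i _; have [_ /andP[]] := Lu s sz Ds i.
- apply: (@le_trans _ _ (iid_expect P (n * m) (fun s => (\sum_(i < n) (L i s + N%:R^-1))%:E))).
    apply: (le_iid_expect P D) => // s sz Ds; rewrite lee_fin.
      apply: sumr_ge0 => i _; have [L0 /andP[/(le_trans L0)]] := Lu s sz Ds i.
      by [].
    by apply: ler_sum => i _; have [_ /andP[]] := Lu s sz Ds i.
  have Lw' i : has_iid P (n * m) (fun s => L i s + N%:R^-1) (w i + N%:R^-1).
    by apply: has_iidD => //; exact: has_iid_cst.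
  rewrite (has_iidE _ _ _ _ (has_iid_sum _ _ _ _ _ _ Lw')) lee_fin.
  apply: ler_sum => i _; have := wb i; rewrite ler_norml mulr2n => /andP[].
  by move: (_ / m.+1%:R) (w i) => x y; lra.
Qed.

(** Lets the mesh [1 / N] tend to 0 in [expected_sw_approx]. *)
Lemma expected_sw_borda (n m : nat) (sigma : profile n m) (j : 'I_m) :
  (((borda sigma j)%:R / m.+1%:R - n%:R * eps)%:E <= expected_sw P sigma j /\
   expected_sw P sigma j <= ((borda sigma j)%:R / m.+1%:R + n%:R * eps)%:E)%E.
Proof.
have small d : 0 < d -> exists2 N, (0 < N)%N & n%:R * (N%:R^-1 *+ 2) <= d :> R.
  move=> d0; exists (Num.truncn (n%:R *+ 2 / d)).+1 => //.
  rewrite mulrnAr -mulrnAl ler_pdivrMr ?ltr0n// mulrC -ler_pdivrMr//.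
  exact/ltW/truncnS_gt.
split; apply/lee_addgt0Pr => d d0; have [N N0 Nd] := small d d0;
  have [lo up] := expected_sw_approx _ _ sigma j N N0.
- have Ni : 0 <= N%:R^-1 :> R by rewrite invr_ge0.
  have nN : 0 <= n%:R * N%:R^-1 :> R by rewrite mulr_ge0.
  rewrite -leeBlDr//; apply: le_trans lo.
  rewrite -EFinB lee_fin mulrDr; rewrite mulr2n mulrDr in Nd.
  by move: (_ / m.+1%:R) => x; lra.
- apply: (le_trans up); rewrite -EFinD lee_fin mulrDr.
  by move: (_ / m.+1%:R) => x; lra.
Qed.

End ExpectedWelfare.

(** * Borda averages and the approximation ratio *)

(** Each ranking is a permutation, so every voter hands out [1 + ... + m] points; doubling avoids
    division. *)
Lemma sum_borda (n m : nat) (sigma : profile n m) :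
  ((\sum_(j < m) borda sigma j) * 2 = n * (m * m.+1))%N.
Proof.
rewrite /borda exchange_big /= (eq_bigr (fun=> \sum_(r < m) (m - r)))%N => [|i _]; last first.
  by rewrite [RHS](reindex_inj (@perm_inj _ (sigma i)))/=; apply: eq_bigr => j _; rewrite subSS.
rewrite sum_nat_const card_ord -mulnA; congr (_ * _)%N.
elim: m {sigma} => [|m IH]; first by rewrite big_ord0.
by rewrite big_ord_recl subn0 mulnDl (eq_bigr (fun r : 'I_m => m - r)%N)// IH; lia.
Qed.

Lemma borda_winner_ge (n m : nat) (sigma : profile n m) (b : 'I_m) :
  (forall j : 'I_m, borda sigma j <= borda sigma b)%N -> (n * m.+1 <= borda sigma b * 2)%N.
Proof.
move=> bmax; have m0 : (0 < m)%N by case: m b {sigma bmax} => // -[].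
rewrite -(leq_pmul2l m0) mulnCA -(sum_borda _ _ sigma) mulnA leq_mul2r/=.
by apply: leq_trans (leq_sum _ (fun j _ => bmax j)) _; rewrite sum_nat_const card_ord.
Qed.

Theorem theorem12 (R : realType) (P : probability R R) (eps : R)
  (Psupp : P [set` `[0, 1]] = 1%E)
  (Pcont : forall x : R, P [set x] = 0%E)
  (Pinv : set_bij [set` `[0, 1]] [set` `[0, 1]] (dist_cdf P))
  (Ptv : (tv_unif P <= eps%:E)%E)
  (heps : eps <= 1 / 10)
  (n m : nat) (sigma : profile n m) (b : 'I_m)
  (bmax : forall j : 'I_m, (borda sigma j <= borda sigma b)%N) :
  ((1 - 5 * eps)%:E * \big[maxe/-oo%E]_(j < m) expected_sw P sigma j
     <= expected_sw P sigma b)%E.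
Proof.
have eps0 : 0 <= eps by rewrite -lee_fin (le_trans (tv_unif_ge0 P)).
have [lo _] := expected_sw_borda P eps Psupp Ptv n m sigma b.
set B : R := (borda sigma b)%:R / m.+1%:R in lo *.
have le_max : (\big[maxe/-oo%E]_(j < m) expected_sw P sigma j <= (B + n%:R * eps)%:E)%E.
  apply/bigmax_leP; split => [|j _]; first exact: leNye.
  have [_ up] := expected_sw_borda P eps Psupp Ptv n m sigma j.
  apply: (le_trans up); rewrite lee_fin lerD2r ler_pM2r ?invr_gt0 ?ltr0n//.
  by rewrite ler_nat.
have nB : n%:R <= B * 2.
  by rewrite /B mulrAC ler_pdivlMr ?ltr0n// -!natrM ler_nat; exact: borda_winner_ge.
have c0 : 0 <= 1 - 5 * eps by lra.
apply: le_trans (lee_wpmul2l _ le_max) _; first by rewrite lee_fin.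
(* What remains amounts to [2 n eps <= 5 eps B + 5 n eps^2], and [nB] gives [2 n eps <= 4 eps B]. *)
apply: le_trans lo; rewrite -EFinM lee_fin.
have n0 : 0 <= n%:R :> R by [].
nra.
Qed.
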